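(* Let $k,m\ge1$ be integers with $k$ dividing $m$, let $\lambda\in[\tfrac1m,1]$ and $t=\lfloor 1/\lambda\rfloor$. Let $$\mathsf{R}_d^\star(\lambda)=\max_{P_{B^m}}\ \min_{\substack{Q_X\in\Delta_m\\ \|Q_X\|_\infty\le\lambda}}\ \mathbb{E}_{B^m\sim P_{B^m}}\big[\mathsf{R}_d(Q_X,B^m)\big],$$ where $P_{B^m}$ ranges over all probability distributions on $[k]^m$ and $\mathsf{R}_d(Q_X,b^m)$ is the detection probability of the Correlated Channel watermark. Then $$\mathsf{R}_d^\star(\lambda)=1-\frac1{2k}-\frac14 G,$$ where $$G=k\sum_{c=0}^{t}\frac{\binom{m/k}{c}\binom{m-m/k}{t-c}}{\binom{m}{t}}\left(\frac{(m/k)-c}{m-t}\left|c\lambda+(1-\lambda t)-\frac1k\right|+\left(1-\frac{(m/k)-c}{m-t}\right)\left|c\lambda-\frac1k\right|\right)$$ (if $t=m$, the quotient $\frac{(m/k)-c}{m-t}$ is read as $0$). Furthermore, the maximum over $P_{B^m}$ is attained by the uniform distribution on the set of sequences $b^m\in[k]^m$ in which each element of $[k]$ occurs exactly $m/k$ times. In particular, for a two-element alphabet $\{0,1\}$ (the case $k=2$) it is attained by the uniform distribution on $\{b^m\in\{0,1\}^m: b^m\text{ has equally many }0\text{'s and }1\text{'s}\}$.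
   Context: $\mathcal{X}=[m]=\{1,\dots,m\}$ is the token vocabulary, $\mathcal{S}=[k]$ (for $k=2$ one may relabel it as $\{0,1\}$), $\Delta_m$ is the probability simplex on $[m]$, $\|Q\|_\infty=\max_x Q(x)$. Correlated Channel (CC) watermark: let $S$ be uniform on $[k]$. For $Q_X\in\Delta_m$ and $b^m=(b_1,\dots,b_m)\in[k]^m$, let $Y=b_X$ with $X\sim Q_X$, so $P_Y(s)=\sum_{x:b_x=s}Q_X(x)$. Choose a coupling $P_{S,Y}$ of the uniform distribution $P_S$ and $P_Y$ maximizing $\Pr(S=Y)$, and define the watermarked token distribution given $S=s$ by $Q_{X|s,b^m}(x)=Q_X(x)\,P_{S|Y}(s\mid b_x)/P_S(s)$. A fair coin $C$, independent of everything else, is flipped; if $C=0$ the token $A\sim Q_X$ is drawn independently of $S$, and if $C=1$ then $A\sim Q_{X|S,b^m}$. The detector declares ''watermarked'' if and only if $b_A=S$. The detection probability is $$\mathsf{R}_d(Q_X,b^m)=\tfrac12\Pr(b_A=S\mid C=1)+\tfrac12\Pr(b_A\ne S\mid C=0).$$ *)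

(* Defs.v *)
From HB Require Import structures.
From mathcomp Require Import all_boot all_order all_algebra.
From mathcomp Require Import boolp reals.
Set Implicit Arguments.
Unset Strict Implicit.
Unset Printing Implicit Defensive.
Import Order.TTheory GRing.Theory Num.Theory.
Local Open Scope ring_scope.

Definition is_dist (R : realType) (T : finType) (P : {ffun T -> R}) : Prop :=
  (forall x, 0 <= P x) /\ \sum_x P x = 1.

Definition unif (R : realType) (T : finType) (A : {set T}) : {ffun T -> R} :=
  [ffun x => (x \in A)%:R / #|A|%:R].

Definition prob (R : realType) (T : finType) (P : {ffun T -> R})
  (E : pred T) : R := \sum_(x | E x) P x.

Definition cprob (R : realType) (T : finType) (P : {ffun T -> R})
  (E F : pred T) : R := prob P (predI E F) / prob P F.

Definition expect (R : realType) (T : finType) (P : {ffun T -> R})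
  (f : T -> R) : R := \sum_x P x * f x.

Definition is_coupling (R : realType) (S : finType) (p q : {ffun S -> R})
  (P : {ffun S * S -> R}) : Prop :=
  [/\ forall w, 0 <= P w,
      forall s, \sum_y P (s, y) = p s &
      forall y, \sum_s P (s, y) = q y].

Definition is_max_coupling (R : realType) (S : finType) (p q : {ffun S -> R})
  (P : {ffun S * S -> R}) : Prop :=
  is_coupling p q P /\
  forall P', is_coupling p q P' ->
    prob P' (fun w => w.1 == w.2) <= prob P (fun w => w.1 == w.2).

Definition PS (R : realType) (S : finType) : {ffun S -> R} := unif R [set: S].

Definition PY (R : realType) (S : finType) (m : nat) (Q : {ffun 'I_m -> R})
  (b : {ffun 'I_m -> S}) : {ffun S -> R} := [ffun s => \sum_(x | b x == s) Q x].

(* The channel does not say which maximal coupling is used: phi is one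
   arbitrary choice of a maximal coupling of P_S and P_Y for each Q and b;
   such a choice exists by max_choice_exists below. *)
Definition coupling_choice (R : realType) (S : finType) (m : nat) : Type :=
  {ffun 'I_m -> R} -> {ffun 'I_m -> S} -> {ffun S * S -> R}.

Definition is_max_choice (R : realType) (S : finType) (m : nat)
  (phi : coupling_choice R S m) : Prop :=
  forall Q b, is_dist Q -> is_max_coupling (PS R S) (PY Q b) (phi Q b).

(* If P_Y(b_x) = 0 then Q(x) = 0, so the value of the undefined conditional
   probability P_(S|Y)(s | b_x) is immaterial. *)
Definition Qwm (R : realType) (S : finType) (m : nat)
  (phi : coupling_choice R S m) (Q : {ffun 'I_m -> R})
  (b : {ffun 'I_m -> S}) (s : S) (x : 'I_m) : R :=
  Q x * (phi Q b (s, b x) / PY Q b (b x)) / PS R S s.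

(* Joint law of (C, S, A); C = 1 is encoded as true. *)
Definition joint (R : realType) (S : finType) (m : nat)
  (phi : coupling_choice R S m) (Q : {ffun 'I_m -> R})
  (b : {ffun 'I_m -> S}) : {ffun bool * S * 'I_m -> R} :=
  [ffun w => let: (c, s, a) := w in
     2^-1 * PS R S s * (if c then Qwm phi Q b s a else Q a)].

Definition Rd (R : realType) (S : finType) (m : nat)
  (phi : coupling_choice R S m) (Q : {ffun 'I_m -> R})
  (b : {ffun 'I_m -> S}) : R :=
  let J := joint phi Q b in
    2^-1 * cprob J (fun w => b w.2 == w.1.2) (fun w => w.1.1 == true)
  + 2^-1 * cprob J (fun w => b w.2 != w.1.2) (fun w => w.1.1 == false).

(* The neutral element 0 is harmless in the norm since Q is nonnegative. *)
Definition feasible (R : realType) (m : nat) (lambda : R)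
  (Q : {ffun 'I_m -> R}) : Prop :=
  is_dist Q /\ \big[Num.max/0]_x Q x <= lambda.

Definition is_min_over (R : realType) (T : Type) (D : T -> Prop) (f : T -> R)
  (v : R) : Prop :=
  (exists2 x, D x & f x = v) /\ forall x, D x -> v <= f x.

Definition is_max_over (R : realType) (T : Type) (D : T -> Prop) (f : T -> R)
  (v : R) : Prop :=
  (exists2 x, D x & f x = v) /\ forall x, D x -> f x <= v.

Definition is_worst_case (R : realType) (S : finType) (m : nat)
  (phi : coupling_choice R S m) (lambda : R)
  (PB : {ffun {ffun 'I_m -> S} -> R}) (v : R) : Prop :=
  is_min_over (feasible lambda) (fun Q => expect PB (Rd phi Q)) v.

(* v is the max-min value R_d^*(lambda): the inner minimum is attained for
   every PB, and v is the attained maximum of these minima W PB. *)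
Definition is_Rdstar (R : realType) (S : finType) (m : nat)
  (phi : coupling_choice R S m) (lambda v : R) : Prop :=
  exists W : {ffun {ffun 'I_m -> S} -> R} -> R,
    (forall PB, is_dist PB -> is_worst_case phi lambda PB (W PB)) /\
    is_max_over (@is_dist R _) W v.

Definition is_maximizer (R : realType) (S : finType) (m : nat)
  (phi : coupling_choice R S m) (lambda : R)
  (PB : {ffun {ffun 'I_m -> S} -> R}) : Prop :=
  is_dist PB /\
  exists2 v, is_Rdstar phi lambda v & is_worst_case phi lambda PB v.

Definition balanced (m k : nat) : {set {ffun 'I_m -> 'I_k}} :=
  [set b : {ffun 'I_m -> 'I_k} |
     [forall s, #|[set i | b i == s]| == (m %/ k)%N]].

Definition balanced_bits (m : nat) : {set {ffun 'I_m -> bool}} :=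
  [set b : {ffun 'I_m -> bool} |
     #|[set i | b i == false]| == #|[set i | b i == true]|].

(* For t = m the quotient is 0, since division by 0 gives 0 here. *)
Definition fill_ratio (R : realType) (m k t c : nat) : R :=
  ((m %/ k)%:R - c%:R) / (m%:R - t%:R).

Definition Gterm (R : realType) (m k t : nat) (lambda : R) : R :=
  k%:R * \sum_(0 <= c < t.+1)
    'C(m %/ k, c)%:R * 'C(m - m %/ k, t - c)%:R / 'C(m, t)%:R *
    (fill_ratio R m k t c * `|c%:R * lambda + (1 - lambda * t%:R) - k%:R^-1|
     + (1 - fill_ratio R m k t c) * `|c%:R * lambda - k%:R^-1|).

Lemma max_coupling_exists (R : realType) (S : finType) (p q : {ffun S -> R}) :
  is_dist p -> is_dist q -> exists P, is_max_coupling p q P.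
Proof.
move=> [p0 p1] [q0 q1].
pose d s := Num.min (p s) (q s).
have dp s : d s <= p s by rewrite ge_min lexx.
have dq s : d s <= q s by rewrite ge_min lexx orbT.
have d0 s : 0 <= d s by rewrite le_min p0 q0.
pose D := 1 - \sum_s d s.
have Dp : \sum_s (p s - d s) = D by rewrite sumrB p1.
have Dq : \sum_s (q s - d s) = D by rewrite sumrB q1.
have D0 : 0 <= D by rewrite -Dp sumr_ge0 // => s _; rewrite subr_ge0.
have cancelD (f : S -> R) s : (forall s, 0 <= f s) -> \sum_s f s = D ->
    f s * (D / D) = f s.
  move=> f0 fD; have [DE|DN] := eqVneq D 0; last by rewrite divff // mulr1.
  rewrite (_ : f s = 0) ?mul0r //; apply: le_anti; rewrite f0 andbT -DE -fD.
  by rewrite (bigD1 s) //= lerDl sumr_ge0.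
pose P := [ffun w : S * S => (w.1 == w.2)%:R * d w.1
             + (p w.1 - d w.1) * (q w.2 - d w.2) / D].
have diag (g : {ffun S * S -> R}) :
    prob g (fun w => w.1 == w.2) = \sum_s g (s, s).
  rewrite /prob (eq_bigl (fun w : S * S => true && (w.1 == w.2))) //.
  rewrite (eq_bigr (fun w => g (w.1, w.2))); last by case.
  rewrite -(pair_big_dep xpredT (fun i j => i == j) (fun i j => g (i, j))) /=.
  by apply: eq_bigr => s _; rewrite (big_pred1 s) // => y; rewrite eq_sym.
exists P; split; first split.
- case=> s y; rewrite ffunE /= addr_ge0 ?mulr_ge0 ?ler0n ?invr_ge0 //;
    by rewrite subr_ge0.
- move=> s; under eq_bigr do rewrite ffunE /=.
  rewrite big_split /= (bigD1 s) //= eqxx mul1r big1 ?addr0; last first.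
    by move=> y /negPf ys; rewrite eq_sym ys mul0r.
  rewrite -mulr_suml -mulr_sumr Dq -mulrA (cancelD (fun s => p s - d s)) ?subrKC //.
  by move=> y; rewrite subr_ge0.
- move=> y; under eq_bigr do rewrite ffunE /=.
  rewrite big_split /= (bigD1 y) //= eqxx mul1r big1 ?addr0; last first.
    by move=> s /negPf ys; rewrite ys mul0r.
  rewrite -mulr_suml -mulr_suml Dp [D * _]mulrC -mulrA
    (cancelD (fun y => q y - d y)) ?subrKC //.
  by move=> s; rewrite subr_ge0.
move=> P' [P'0 P'p P'q]; rewrite !diag; apply: ler_sum => s _.
apply: (@le_trans _ _ (d s)).
  rewrite le_min -P'p -P'q.
  by rewrite (bigD1 s) //= lerDl sumr_ge0 //= (bigD1 s) //= lerDl sumr_ge0.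
rewrite ffunE /= eqxx mul1r lerDl mulr_ge0 ?invr_ge0 //.
by rewrite mulr_ge0 // subr_ge0.
Qed.

Lemma max_choice_exists (R : realType) (S : finType) (m : nat) :
  (0 < #|S|)%N -> exists phi : coupling_choice R S m, is_max_choice phi.
Proof.
move=> S0.
have PSd : is_dist (PS R S).
  split=> [x|]; first by rewrite ffunE divr_ge0.
  under eq_bigr do rewrite ffunE in_setT cardsT mul1r.
  by rewrite sumr_const -[LHS]mulr_natr mulVf // pnatr_eq0 -lt0n.
have PYd (Q : {ffun 'I_m -> R}) (b : {ffun 'I_m -> S}) :
    is_dist Q -> is_dist (PY Q b).
  move=> [Q0 Q1]; split=> [s|]; first by rewrite ffunE sumr_ge0.
  under eq_bigr do rewrite ffunE.
  by rewrite -Q1 (partition_big b xpredT).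
have ex (Qb : {ffun 'I_m -> R} * {ffun 'I_m -> S}) : exists P,
    is_dist Qb.1 -> is_max_coupling (PS R S) (PY Qb.1 Qb.2) P.
  have [Qd|nQd] := pselect (is_dist Qb.1); last by exists [ffun=> 0].
  by have [P HP] := max_coupling_exists PSd (PYd _ Qb.2 Qd); exists P.
have [f Hf] := choice ex.
by exists (fun Q b => f (Q, b)) => Q b Qd; apply: (Hf (Q, b)).
Qed.

(* Main.v *)
(* A maximal coupling of p and q puts mass min (p s) (q s) at (s, s), so Rd is
   1 - 1/(2k) - D/4 with D(Q, b) = sum_s |P_Y(s) - 1/k|, and everything reduces
   to minimizing over P_B the maximum over feasible Q of E[D(Q, B)].  D is
   convex in Q, so the maximum is attained at an extreme point of the feasible
   polytope: lambda on a t-set T, 1 - lambda t at one further point y.  For a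
   lower bound, average over all these extreme points: for fixed b the average
   of |Q(b^-1(s)) - 1/k| depends only on the cardinality n_s of b^-1(s), and is
   a convex function f of n_s because Q is nonnegative and |.| is convex.  As
   the n_s sum to m, Jensen gives at least k f(m/k).  For balanced b this is an
   equality, and permutation invariance of the balanced maps makes E[D(Q, B)]
   the same at all extreme points.  Counting the sets T with c elements in a
   given set of m/k points identifies k f(m/k) with G. *)

Require Import Defs.
From mathcomp Require Import all_boot all_order all_algebra all_fingroup.
From mathcomp Require Import reals.
From mathcomp Require Import zify ring lra.
Import Order.TTheory GRing.Theory Num.Theory.
Set Implicit Arguments.
Unset Strict Implicit.
Local Open Scope ring_scope.

(** * Sets and permutations *)

(** Induction on [#|A :\: B|]: a transposition of a point of [A :\: B] with one of [B :\: A] brings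
    [A] closer to [B]. *)
Lemma perm_of_card (T : finType) (A B : {set T}) :
  #|A| = #|B| -> exists s : {perm T}, forall x, (s x \in B) = (x \in A).
Proof.
move: {2}#|A :\: B| (leqnn #|A :\: B|) => n; elim: n A => [|n IHn] A.
  rewrite leqn0 cards_eq0 setD_eq0 => AB eqAB; exists 1%g => x.
  by rewrite perm1; apply/esym; move: x; apply/setP/eqP; rewrite eqEcard AB eqAB /=.
move=> leAB eqAB; have [AB|] := boolP (A \subset B).
  exists 1%g => x.
  by rewrite perm1; apply/esym; move: x; apply/setP/eqP; rewrite eqEcard AB eqAB /=.
case/subsetPn => x xA xB.
have: ~~ (B \subset A).
  apply: contra xB => BA; suff -> : B = A by [].
  by apply/eqP; rewrite eqEcard BA eqAB /=.
case/subsetPn => y yB yA.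
pose p := tperm x y; pose A' := [set z | p z \in A].
have A'E : A' = y |: (A :\ x).
  apply/setP=> z; rewrite !inE /p; case: tpermP => [->|->|/eqP zx /eqP zy].
  - by rewrite eqxx /= (negPf yA) orbF; apply/esym/negbTE; apply: contraNneq yA => <-.
  - by rewrite eqxx /= xA.
  - by rewrite (negPf zy) zx.
have [||s Hs] := IHn A'; rewrite -?/A'.
- rewrite -ltnS; apply: leq_trans leAB; apply: proper_card.
  apply/properP; split.
    apply/subsetP => z; rewrite A'E !inE => /andP[zB].
    by case/orP=> [/eqP zy|/andP[_ ->]]; [rewrite zy yB in zB|rewrite zB].
  by exists x; rewrite !inE xB //= tpermL.
- by rewrite -eqAB -/A' A'E cardsU1 !inE (negPf yA) andbF /= (cardsD1 x A) xA.
exists (p * s)%g => z; rewrite permM Hs inE /p tpermK //.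
Qed.

(** [B] corresponds to the pair of [B :&: A] and [B :\: A], chosen independently in [A] and in its
    complement. *)
Lemma card_setI_draws (T : finType) (A : {set T}) (t c : nat) : (c <= t)%N ->
  #|[set B : {set T} | (#|B| == t) && (#|B :&: A| == c)]|
    = ('C(#|A|, c) * 'C(#|T| - #|A|, t - c))%N.
Proof.
move=> ct; have -> : (#|T| - #|A|)%N = #|~: A| by rewrite -(cardsC A) addKn.
rewrite -!cards_draws -cardsX.
have injU : {in setX [set B : {set T} | (B \subset A) & (#|B| == c)]
                 [set B : {set T} | (B \subset ~: A) & (#|B| == t - c)%N] &,
             injective (fun p : {set T} * {set T} => p.1 :|: p.2)}.
  move=> [B C] [B' C']; rewrite !inE /= => /andP[/andP[BA _] /andP[CA _]].
  move=> /andP[/andP[BA' _] /andP[CA' _]] E.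
  move: (congr1 (fun D => (D :&: A, D :\: A)) E); rewrite !setIUl !setDUl.
  have dI (X : {set T}) : X \subset ~: A -> X :&: A = set0.
    by rewrite subsets_disjoint setCK => /disjoint_setI0.
  have dD (X : {set T}) : X \subset ~: A -> X :\: A = X by rewrite setDE => /setIidPl.
  rewrite (dI _ CA) (dI _ CA') (dD _ CA) (dD _ CA') !setU0.
  rewrite (setIidPl BA) (setIidPl BA').
  have [-> ->] : B :\: A = set0 /\ B' :\: A = set0.
    by split; apply/eqP; rewrite setD_eq0.
  by rewrite !set0U.
rewrite -(card_in_imset injU); apply: eq_card => B; rewrite inE.
apply/andP/imsetP => [[/eqP Bt /eqP BA]|[[C D] + ->]].
  exists (B :&: A, B :\: A) => /=; last by rewrite setID.
  rewrite !inE subsetIr BA eqxx setDE subsetIr /= -setDE cardsD BA Bt //.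
rewrite !inE /= => /andP[/andP[CA /eqP Cc] /andP[DA /eqP Dt]].
have DA0 : D :&: A = set0.
  by apply: disjoint_setI0; rewrite subsets_disjoint setCK in DA.
split; last by rewrite setIUl DA0 setU0 (setIidPl CA) Cc.
rewrite cardsU Cc Dt (_ : C :&: D = set0) ?cards0 ?subn0 ?subnKC //.
by apply/eqP; rewrite -subset0 -DA0 setIC setIS.
Qed.

(** * Extreme points of the feasible polytope *)

Definition vertex (R : realType) (m : nat) (lambda : R) (t : nat)
    (w : {set 'I_m} * 'I_m) : {ffun 'I_m -> R} :=
  [ffun x => if x \in w.1 then lambda
             else if x == w.2 then 1 - lambda * t%:R else 0].

(* If t = m there is no point outside T; then 1 - lambda t = 0 for the relevant
   lambda, and y is left arbitrary to keep the index set nonempty. *)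
Definition vertices (m t : nat) : {set {set 'I_m} * 'I_m} :=
  [set w : {set 'I_m} * 'I_m | (#|w.1| == t)
     && ((w.2 \notin w.1) || (w.1 == [set: 'I_m]))].

Definition convex_fun (R : realType) (m : nat) (F : {ffun 'I_m -> R} -> R) :=
  forall (a : R) (Q Q1 Q2 : {ffun 'I_m -> R}), 0 <= a <= 1 ->
    (forall x, Q x = a * Q1 x + (1 - a) * Q2 x) ->
    F Q <= a * F Q1 + (1 - a) * F Q2.

(** The number of these coordinates is the measure for the descent to an extreme point, where at
    most one is left. *)
Definition interior (R : realType) (m : nat) (lambda : R)
    (Q : {ffun 'I_m -> R}) : {set 'I_m} := [set x | 0 < Q x < lambda].

Definition shift (R : realType) (m : nat) (Q : {ffun 'I_m -> R}) (x y : 'I_m)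
    (e : R) : {ffun 'I_m -> R} :=
  [ffun z => Q z + e * ((z == x)%:R - (z == y)%:R)].

Lemma feasibleP (R : realType) (m : nat) (lambda : R) (Q : {ffun 'I_m -> R}) :
  0 <= lambda ->
  feasible lambda Q <-> is_dist Q /\ forall x, Q x <= lambda.
Proof.
move=> lam0; split=> -[Qd Ql]; split=> //.
  by move=> x; apply: le_trans Ql; apply: le_bigmax.
by apply: bigmax_le.
Qed.

Lemma sum_vertex (R : realType) (m : nat) (lambda : R) (t : nat)
    (w : {set 'I_m} * 'I_m) (A : {set 'I_m}) :
  \sum_(x in A) vertex lambda t w x
    = #|w.1 :&: A|%:R * lambda
      + ((w.2 \in A) && (w.2 \notin w.1))%:R * (1 - lambda * t%:R).
Proof.
rewrite (bigID (mem w.1)) /=; congr (_ + _).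
  rewrite (eq_bigr (fun=> lambda)); last by move=> x /andP[_ xw]; rewrite ffunE xw.
  rewrite sumr_const -[LHS]mulr_natl; congr (_%:R * _).
  by apply: eq_card => x; rewrite !inE andbC.
have [/andP[wA ww]|nw] := boolP (_ && _); rewrite ?mul0r ?mul1r.
  rewrite (bigD1 w.2) ?wA //= ffunE (negPf ww) eqxx big1 ?addr0 //.
  by move=> x /andP[/andP[_ xw] /negPf xw2]; rewrite ffunE (negPf xw) xw2.
rewrite big1 // => x xP; rewrite ffunE; move/andP: (xP) => [_ /negPf ->].
by case: eqP => // xw; rewrite xw (negPf nw) in xP.
Qed.

(** Mass moves from [y] to [x] until [Q x] reaches [lambda] or [Q y] reaches 0; that coordinate
    leaves the interior. *)
Lemma shift_feasible (R : realType) (m : nat) (lambda : R)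
    (Q : {ffun 'I_m -> R}) (x y : 'I_m) :
  0 <= lambda -> feasible lambda Q -> x != y ->
  x \in interior lambda Q -> y \in interior lambda Q ->
  exists e, [/\ 0 < e, feasible lambda (shift Q x y e)
    & (#|interior lambda (shift Q x y e)| < #|interior lambda Q|)%N].
Proof.
move=> lam0 /(feasibleP _ lam0)[[Q0 Q1] Ql] xy.
rewrite !inE => /andP[x0 xl] /andP[y0 yl].
pose e := Num.min (lambda - Q x) (Q y); exists e.
have e0 : 0 < e by rewrite /e lt_min y0 subr_gt0 xl.
have ex : e <= lambda - Q x by rewrite /e ge_min lexx.
have ey : e <= Q y by rewrite /e ge_min lexx orbT.
have yx : y == x = false by rewrite eq_sym (negPf xy).
have sx : shift Q x y e x = Q x + e by rewrite ffunE eqxx (negPf xy) subr0 mulr1.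
have sy : shift Q x y e y = Q y - e by rewrite ffunE eqxx yx sub0r mulrN1.
have sz z : z != x -> z != y -> shift Q x y e z = Q z.
  by move=> /negPf zx /negPf zy; rewrite ffunE zx zy subrr mulr0 addr0.
split=> //.
  apply/(feasibleP _ lam0); split; last first.
    move=> z; have [->|zx] := eqVneq z x; first by rewrite sx; lra.
    by have [->|zy] := eqVneq z y; [rewrite sy; lra|rewrite sz].
  split.
    move=> z; have [->|zx] := eqVneq z x; first by rewrite sx; lra.
    by have [->|zy] := eqVneq z y; [rewrite sy; lra|rewrite sz].
  rewrite (bigD1 x) //= (bigD1 y) ?yx //= sx sy.
  under eq_bigr => z /andP[zx zy] do rewrite sz //.
  by move: Q1; rewrite (bigD1 x) //= (bigD1 y) ?yx //= => <-; ring.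
apply: proper_card; apply/properP; split.
  apply/subsetP => z; rewrite !inE.
  have [->|zx] := eqVneq z x; first by rewrite x0 xl.
  by have [->|zy] := eqVneq z y; [rewrite y0 yl|rewrite sz].
have [le|lt] := leP (lambda - Q x) (Q y).
  by exists x; rewrite ?inE ?x0 // sx /e min_l // subrKC ltxx andbF.
by exists y; rewrite ?inE ?y0 // sy /e min_r ?ltW // subrr ltxx.
Qed.

(** All coordinates but at most one are 0 or [lambda]. Hence 1 is [#|T| * lambda] plus a remainder
    in [[0, lambda)], where [T] is the saturated set, and this forces [#|T| = t]. *)
Lemma vertex_of_feasible (R : realType) (m t : nat) (lambda : R)
    (Q : {ffun 'I_m -> R}) :
  (0 < m)%N -> t%:R * lambda <= 1 < t.+1%:R * lambda ->
  feasible lambda Q -> (#|interior lambda Q| <= 1)%N ->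
  exists2 w, w \in vertices m t & Q = vertex lambda t w.
Proof.
move=> m0 /andP[t1 t2].
have lam0 : 0 < lambda by rewrite -natr1 in t2; lra.
move=> /(feasibleP _ (ltW lam0))[[Q0 Q1] Ql] /card_le1_eqP int1.
pose T := [set x | Q x == lambda].
(* [y] is the interior coordinate if there is one, else a point outside [T], else arbitrary. *)
have [y yT Hy] : exists2 y, (y \notin T) || (T == setT) &
    forall x, x \notin T -> x != y -> Q x = 0.
  have Qz x : x \notin T -> x \notin interior lambda Q -> Q x = 0.
    rewrite !inE lt_neqAle Q0 andbT lt_neqAle Ql andbT => -> /=.
    by rewrite andbT negbK => /eqP.
  have [int0|[y yI]] := set_0Vmem (interior lambda Q).
    have [TT|] := eqVneq T setT.
      by exists (Ordinal m0); rewrite ?TT ?orbT // => x; rewrite in_setT.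
    rewrite -subTset => /subsetPn[y _ yT]; exists y; rewrite ?yT // => x xT _.
    by apply: Qz; rewrite // int0 inE.
  exists y => [|x xT xy].
    by move: yI; rewrite !inE => /andP[_ /lt_eqF ->].
  by apply: Qz => //; apply: contraNN xy => xI; apply/eqP/int1.
(* If [y] lies in [T], its mass is already counted there. *)
pose r := if y \in T then 0 else Q y.
have r0 : 0 <= r < lambda.
  rewrite /r; case: ifPn => [_|]; rewrite ?lexx // Q0 inE => yl.
  by rewrite lt_neqAle yl Ql.
have QE x : Q x = if x \in T then lambda else if x == y then r else 0.
  case: ifPn => [|xT]; first by rewrite inE => /eqP.
  by case: eqVneq => [xy|xy]; [rewrite /r -xy (negPf xT)|apply: Hy].
have sumT : #|T|%:R * lambda + r = 1.
  rewrite -[RHS]Q1 (bigID (mem T)) /=; congr (_ + _).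
    rewrite (eq_bigr (fun=> lambda)) => [|x]; last by rewrite inE => /eqP.
    by rewrite sumr_const mulr_natl.
  have [yT'|yT'] := boolP (y \in T).
    rewrite big1 /r ?yT' // => x xT; apply: Hy => //.
    by apply: contraNneq xT => ->.
  rewrite (bigD1 y) //= big1 /r ?(negPf yT') ?addr0 //.
  by move=> x /andP[]; apply: Hy.
have Tt : #|T| = t.
  apply/eqP; rewrite eqn_leq; apply/andP; split; rewrite leqNgt; apply/negP => lt.
    have : t.+1%:R * lambda <= #|T|%:R * lambda by rewrite ler_pM2r // ler_nat.
    by move: (#|T|%:R * lambda) sumT => z; lra.
  have : #|T|.+1%:R * lambda <= t%:R * lambda by rewrite ler_pM2r // ler_nat.
  by rewrite -natr1 mulrDl; move: (#|T|%:R * lambda) sumT => z; lra.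
exists (T, y); first by rewrite inE Tt eqxx.
apply/ffunP => x; rewrite ffunE QE /=; have -> // : 1 - lambda * t%:R = r.
by move: sumT; rewrite Tt; lra.
Qed.

(** Induction on the number of interior coordinates: given two of them, [Q] lies between two
    opposite shifts with fewer interior coordinates, and convexity makes [F] at least as large at
    one of these. *)
Lemma convex_fun_le_vertex (R : realType) (m t : nat) (lambda : R)
    (F : {ffun 'I_m -> R} -> R) (Q : {ffun 'I_m -> R}) :
  (0 < m)%N -> t%:R * lambda <= 1 < t.+1%:R * lambda ->
  convex_fun F -> feasible lambda Q ->
  exists2 w, w \in vertices m t & F Q <= F (vertex lambda t w).
Proof.
move=> m0 ht Fc; have lam0 : 0 <= lambda by rewrite -natr1 in ht; lra.
move: {2}#|interior lambda Q| (leqnn #|interior lambda Q|) => n.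
elim: n Q => [|n IHn] Q Qn Qf.
  by have [|w wV ->] := vertex_of_feasible m0 ht Qf; [apply: leq_trans Qn _|exists w].
have [Q1|] := leqP #|interior lambda Q| 1.
  by have [w wV ->] := vertex_of_feasible m0 ht Qf Q1; exists w.
case/card_gt1P => x [y [xI yI xy]].
have [e [e0 ef en]] := shift_feasible lam0 Qf xy xI yI.
have [d [d0 df dn]] : exists d, [/\ 0 < d, feasible lambda (shift Q y x d)
    & (#|interior lambda (shift Q y x d)| < #|interior lambda Q|)%N].
  by apply: shift_feasible => //; rewrite eq_sym.
have [w wV Fw] := IHn _ (leq_trans en Qn) ef.
have [v vV Fv] := IHn _ (leq_trans dn Qn) df.
have ed0 : 0 < e + d by apply: addr_gt0.
(* The weights are inversely proportional to [e] and [d], so that the opposite shifts cancel. *)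
have a01 : 0 <= d / (e + d) <= 1.
  apply/andP; split; first by rewrite divr_ge0 // ltW.
  by rewrite ler_pdivrMr // mul1r lerDr ltW.
have QE z : Q z = d / (e + d) * shift Q x y e z
    + (1 - d / (e + d)) * shift Q y x d z.
  by rewrite !ffunE; field; rewrite gt_eqF.
have FQ := Fc _ _ _ _ a01 QE; case/andP: a01 => a0 a1.
have [vw|wv] := leP (F (vertex lambda t v)) (F (vertex lambda t w)).
  by exists w => //; nra.
by exists v => //; nra.
Qed.

(** * Averaging over the extreme points *)

(** Increments are nondecreasing, so the sequence stays above its support line at [N]. The backward
    difference as slope stays in the range of convexity even if [N = m]. *)
Lemma convex_seq_support (R : realType) (f : nat -> R) (m N n : nat) :
  (forall i, (i.+2 <= m)%N -> 2 * f i.+1 <= f i.+2 + f i) ->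
  (0 < N <= m)%N -> (n <= m)%N ->
  f N + (n%:R - N%:R) * (f N - f N.-1) <= f n.
Proof.
move=> fc /andP[N0 Nm] nm.
have incr i j : (i <= j < m)%N -> f i.+1 - f i <= f j.+1 - f j.
  case/andP; elim: j => [|j IHj]; first by rewrite leqn0 => /eqP->.
  rewrite leq_eqVlt => /predU1P[-> //|ij jm].
  by have := fc j jm; have := IHj ij (ltnW jm); lra.
have up d : (N + d <= m)%N -> f N + d%:R * (f N - f N.-1) <= f (N + d)%N.
  elim: d => [|d IHd] dm; first by rewrite addn0 mul0r addr0.
  rewrite addnS in dm *; have := IHd (ltnW dm).
  have /incr : (N.-1 <= N + d < m)%N by lia.
  by rewrite prednK // -natr1; lra.
have down d : (d <= N)%N -> f N - d%:R * (f N - f N.-1) <= f (N - d)%N.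
  elim: d => [|d IHd] dN; first by rewrite subn0 mul0r subr0.
  have := IHd (ltnW dN); have /incr : (N - d.+1 <= N.-1 < m)%N by lia.
  by rewrite prednK // subnSK // -natr1; lra.
have [Nn|/ltnW nN] := leqP N n.
  by have := up (n - N)%N; rewrite subnKC // natrB //; apply.
by have := down (N - n)%N (leq_subr _ _); rewrite subKn // natrB // -mulNr opprB.
Qed.

(** Jensen's inequality: the linear terms of the support lines at [N] cancel in the sum. *)
Lemma convex_seq_sum (R : realType) (I : finType) (f : nat -> R) (m N : nat)
    (n : I -> nat) :
  (forall i, (i.+2 <= m)%N -> 2 * f i.+1 <= f i.+2 + f i) ->
  (0 < N <= m)%N -> (forall i, (n i <= m)%N) ->
  (\sum_i n i = #|I| * N)%N ->
  #|I|%:R * f N <= \sum_i f (n i).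
Proof.
move=> fc Nm nm nN.
apply: le_trans (ler_sum _ (fun i _ => convex_seq_support fc Nm (nm i))).
rewrite big_split /= -mulr_suml sumrB -natr_sum nN !sumr_const.
by rewrite natrM -[N%:R *+ _]mulr_natl -[f N *+ _]mulr_natl subrr mul0r addr0.
Qed.

(** [s + u] and [s + v] lie between [s] and [s + u + v] and have the same sum, so convexity of the
    norm applies. *)
Lemma norm_supermodular (R : realType) (s u v : R) : 0 <= u -> 0 <= v ->
  `|s + u| + `|s + v| <= `|s + u + v| + `|s|.
Proof. by move=> u0 v0; do 4!case: ger0P => ?; lra. Qed.

(** An average over the extreme points, left unnormalized; [c] will be [#|S|%:R^-1]. *)
Definition deviation (R : realType) (m : nat) (lambda : R) (t : nat) (c : R)
    (A : {set 'I_m}) : R :=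
  \sum_(w in vertices m t) `|\sum_(x in A) vertex lambda t w x - c|.

Definition permute_vertex (m : nat) (s : {perm 'I_m})
    (w : {set 'I_m} * 'I_m) : {set 'I_m} * 'I_m := (s @: w.1, s w.2).

Lemma permute_vertex_inj (m : nat) (s : {perm 'I_m}) :
  injective (permute_vertex s).
Proof.
by move=> [T y] [T' y'] [/(imset_inj perm_inj) -> /perm_inj ->].
Qed.

Lemma permute_vertex_in (m t : nat) (s : {perm 'I_m}) w :
  (permute_vertex s w \in vertices m t) = (w \in vertices m t).
Proof.
rewrite !inE /= card_imset; last exact: perm_inj.
rewrite mem_imset; last exact: perm_inj.
by rewrite !eqEcard !subsetT /= card_imset; last exact: perm_inj.
Qed.

Lemma vertex_permute (R : realType) (m : nat) (lambda : R) (t : nat)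
    (s : {perm 'I_m}) w x :
  vertex lambda t (permute_vertex s w) (s x) = vertex lambda t w x.
Proof.
rewrite !ffunE /= mem_imset; last exact: perm_inj.
by rewrite (inj_eq perm_inj).
Qed.

(** A permutation carrying [A] to [B] also permutes [vertices m t], so it only reorders the sum. *)
Lemma deviation_card (R : realType) (m : nat) (lambda : R) (t : nat) (c : R)
    (A B : {set 'I_m}) :
  #|A| = #|B| -> deviation lambda t c A = deviation lambda t c B.
Proof.
move=> /perm_of_card[s Hs]; rewrite [RHS](reindex_inj (@permute_vertex_inj _ s)).
apply: eq_big => [w|w _]; first by rewrite permute_vertex_in.
congr `|_ - _|; rewrite [RHS](reindex_inj (@perm_inj _ s)).
by apply: eq_big => [x|x _]; rewrite ?Hs // vertex_permute.
Qed.

(** Initial segments represent the cardinalities. One copy of the middle segment is exchanged for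
    another set of the same size; then [norm_supermodular] applies at each extreme point. *)
Lemma deviation_convex (R : realType) (m : nat) (lambda : R) (t : nat) (c : R)
    (i : nat) :
  0 <= lambda -> t%:R * lambda <= 1 -> (i.+2 <= m)%N ->
  2 * deviation lambda t c [set x : 'I_m | (x < i.+1)%N]
    <= deviation lambda t c [set x : 'I_m | (x < i.+2)%N]
       + deviation lambda t c [set x : 'I_m | (x < i)%N].
Proof.
move=> lam0 lam1 im.
have i1 : (i < m)%N := ltnW im.
pose x := Ordinal i1; pose y := Ordinal im; pose A := [set x : 'I_m | (x < i)%N].
have xA : x \notin A by rewrite inE ltnn.
have yA : y \notin A by rewrite inE /= ltnNge leqnSn.
have xy : y != x by rewrite -val_eqE /= gtn_eqF.
have E1 : [set x : 'I_m | (x < i.+1)%N] = x |: A.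
  by apply/setP => z; rewrite !inE -val_eqE /= ltnS leq_eqVlt.
have E2 : [set x : 'I_m | (x < i.+2)%N] = y |: (x |: A).
  by apply/setP => z; rewrite -E1 !inE -val_eqE /= ltnS leq_eqVlt.
have E3 : deviation lambda t c (x |: A) = deviation lambda t c (y |: A).
  by apply: deviation_card; rewrite !cardsU1 xA yA.
rewrite mulr_natl mulr2n E2 E1 {2}E3 -/A -!big_split /=; apply: ler_sum => w _.
have v0 z : 0 <= vertex lambda t w z.
  by rewrite ffunE; case: ifP => // _; case: ifP => // _; lra.
have yxA : y \notin x |: A by rewrite !inE negb_or xy -leqNgt leqnSn.
rewrite (big_setU1 _ yxA) (big_setU1 _ xA) (big_setU1 _ yA) /=.
have := norm_supermodular (\sum_(z in A) vertex lambda t w z - c) (v0 x) (v0 y).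
set S := \sum_(z in A) _; set X := vertex _ _ _ x; set Y := vertex _ _ _ y.
have -> : X + S - c = S - c + X by ring.
have -> : Y + S - c = S - c + Y by ring.
by have -> : Y + (X + S) - c = S - c + X + Y by ring.
Qed.

(** * Counting the extreme points *)

Lemma sum_vertices (R : realType) (m t : nat) (g : {set 'I_m} -> 'I_m -> R) :
  \sum_(w in vertices m t) g w.1 w.2
    = \sum_(T : {set 'I_m} | #|T| == t)
        \sum_(y | (y \notin T) || (T == [set: 'I_m])) g T y.
Proof. by rewrite pair_big_dep; apply: eq_bigl => w; rewrite inE. Qed.

(** For [t < m] and [T] meeting [A] in [i] points, [q] is the fraction of the points [y] outside [T]
    that lie in [A]. The leading factor is the number of choices of [y] for each [T]. *)
Lemma deviation_closed_form (R : realType) (m : nat) (lambda : R) (t : nat)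
    (c : R) (A : {set 'I_m}) :
  (t <= m)%N ->
  deviation lambda t c A = (if t == m then m else m - t)%N%:R *
    \sum_(0 <= i < t.+1) ('C(#|A|, i) * 'C(m - #|A|, t - i))%N%:R *
      let q := (#|A|%:R - i%:R) / (m%:R - t%:R) in
      q * `|i%:R * lambda + (1 - lambda * t%:R) - c|
      + (1 - q) * `|i%:R * lambda - c|.
Proof.
move=> tm.
(* [r] is 1 if [y] brings the remaining mass into [A], and 0 otherwise. *)
pose h i (r : R) : R := `|i%:R * lambda + r * (1 - lambda * t%:R) - c|.
pose q i : R := (#|A|%:R - i%:R) / (m%:R - t%:R).
pose g i := q i * h i 1 + (1 - q i) * h i 0.
have inner (T : {set 'I_m}) : #|T| = t ->
    \sum_(y | (y \notin T) || (T == [set: 'I_m]))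
       h #|T :&: A| ((y \in A) && (y \notin T))%:R
    = (if t == m then m else m - t)%N%:R * g #|T :&: A|.
  move=> Tt; have [TT|nTT] := eqVneq T setT.
    (* Here [q] is 0 by division by zero, in agreement with [y] lying in [T] and adding no mass. *)
    have tE : t = m by rewrite -Tt TT cardsT card_ord.
    rewrite (eq_bigr (fun=> h #|T :&: A| 0)); last first.
      by move=> y _; rewrite TT in_setT andbF.
    rewrite (eq_bigl xpredT); last by move=> y; rewrite orbT.
    by rewrite sumr_const card_ord tE eqxx /g /q tE subrr invr0 mulr0 mul0r add0r
         subr0 mul1r mulr_natl TT.
  have tm' : (t < m)%N.
    by rewrite ltn_neqAle tm andbT -Tt; apply: contraNneq nTT => Tm;
       rewrite eqEcard subsetT cardsT card_ord Tm leqnn.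
  rewrite (ltn_eqF tm'); under eq_bigl do rewrite orbF.
  rewrite (bigID (mem A)) /=.
  rewrite (eq_bigr (fun=> h #|T :&: A| 1)); last by move=> y /andP[-> ->].
  rewrite [X in _ + X](eq_bigr (fun=> h #|T :&: A| 0)); last first.
    by move=> y /andP[_ /negPf ->].
  rewrite !sumr_const -[h _ 1 *+ _]mulr_natl -[h _ 0 *+ _]mulr_natl.
  (* [a] counts the points of [A] outside [T], and [b] those outside both. *)
  set d := #|T :&: A|; set a := #|_|; set b := #|_|.
  have aE : (a + d = #|A|)%N.
    rewrite -(cardsID T A) addnC setIC; congr (_ + _)%N.
    by apply: eq_card => y; rewrite !inE.
  have bE : (a + b + t = m)%N.
    rewrite -[RHS](card_ord m) -(cardC T) -Tt addnC; congr (_ + _)%N.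
    rewrite -(cardID A [predC T]); congr (_ + _)%N.
    by rewrite /a; apply: eq_card => y; rewrite !inE /= andbC.
  have mtE : (m%:R - t%:R = a%:R + b%:R :> R) by rewrite -bE !natrD addrK.
  have mt0 : a%:R + b%:R != 0 :> R by rewrite -mtE subr_eq0 eqr_nat gtn_eqF.
  rewrite natrB ?(ltnW tm') // /g /q mtE -aE natrD addrK.
  by field.
rewrite /deviation.
have -> : \sum_(w in vertices m t) `|\sum_(x in A) vertex lambda t w x - c|
  = \sum_(w in vertices m t)
     h #|w.1 :&: A| ((w.2 \in A) && (w.2 \notin w.1))%:R.
  by apply: eq_bigr => w _; rewrite sum_vertex.
rewrite (sum_vertices t (fun T y => h #|T :&: A| ((y \in A) && (y \notin T))%:R)).
under eq_bigr => T /eqP Tt do rewrite inner //.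
rewrite -mulr_sumr; congr (_ * _).
rewrite (partition_big (fun T : {set 'I_m} => inord #|T :&: A| : 'I_t.+1) xpredT) //=.
rewrite big_mkord; apply: eq_bigr => i _.
have it : (i <= t)%N by rewrite -ltnS.
have TAt (T : {set 'I_m}) : #|T| == t -> (#|T :&: A| < t.+1)%N.
  by move=> /eqP <-; rewrite ltnS subset_leq_card ?subsetIl.
rewrite (eq_bigr (fun=> g i)); last first.
  by move=> T /andP[/TAt Tt /eqP <-]; rewrite inordK.
rewrite sumr_const /g /h mul1r mul0r addr0 -[LHS]mulr_natl; congr (_%:R * _).
rewrite -[X in (X - _)%N](card_ord m) -card_setI_draws //.
apply: eq_card => T; rewrite !inE; apply: andb_id2l => /TAt Tt.
by rewrite -val_eqE /= inordK.
Qed.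

Lemma card_vertices (m t : nat) : (t <= m)%N ->
  #|vertices m t| = ('C(m, t) * if t == m then m else m - t)%N.
Proof.
move=> tm; rewrite -sum1_card -[m in 'C(m, _)](card_ord m) -card_draws.
rewrite (eq_bigl (fun w : {set 'I_m} * 'I_m => (#|w.1| == t)
    && ((w.2 \notin w.1) || (w.1 == [set: 'I_m])))); last first.
  by move=> w; rewrite inE.
rewrite -(pair_big_dep (fun T : {set 'I_m} => #|T| == t)
    (fun T y => (y \notin T) || (T == [set: 'I_m])) (fun _ _ => 1%N)) /=.
rewrite (eq_bigr (fun=> if t == m then m else m - t)%N).
  by rewrite sum_nat_const; congr (_ * _)%N; apply: eq_card => T; rewrite inE.
move=> T /eqP Tt; rewrite sum1_card.
have [TT|nTT] := eqVneq T setT.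
  rewrite -Tt TT cardsT card_ord eqxx -[RHS]card_ord.
  by apply: eq_card => y; rewrite unfold_in /= orbT.
have tm' : (t < m)%N.
  by rewrite ltn_neqAle tm andbT -Tt; apply: contraNneq nTT => Tm;
     rewrite eqEcard subsetT cardsT card_ord Tm leqnn.
rewrite (ltn_eqF tm') -Tt -[X in (X - _)%N](card_ord m) -(cardC T) addKn.
by apply: eq_card => y; rewrite [LHS]unfold_in /= orbF inE.
Qed.

(** * Detection probability *)

Lemma prob_diag (R : realType) (S : finType) (P : {ffun S * S -> R}) :
  prob P (fun w => w.1 == w.2) = \sum_s P (s, s).
Proof.
rewrite /prob (eq_bigr (fun w => P (w.1, w.2))); last by case.
rewrite -(pair_big_dep xpredT (fun i j => i == j) (fun i j => P (i, j))) /=.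
by apply: eq_bigr => s _; rewrite (big_pred1 s) // => y; rewrite eq_sym.
Qed.

Lemma coupling_diag_le (R : realType) (S : finType) (p q : {ffun S -> R})
    (P : {ffun S * S -> R}) (s : S) :
  is_coupling p q P -> P (s, s) <= Num.min (p s) (q s).
Proof.
move=> [P0 Pp Pq]; rewrite le_min -Pp -Pq; apply/andP; split.
  by rewrite (bigD1 s) //= lerDl sumr_ge0.
by rewrite (bigD1 s) //= lerDl sumr_ge0.
Qed.

(* The mass that p and q share stays on the diagonal; the excesses of p and of
   q, which have disjoint supports, are coupled independently. *)
Lemma coupling_diag_min (R : realType) (S : finType) (p q : {ffun S -> R}) :
  is_dist p -> is_dist q -> exists2 P, is_coupling p q P &
    forall s, P (s, s) = Num.min (p s) (q s).
Proof.
move=> [p0 p1] [q0 q1]; pose d s := Num.min (p s) (q s).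
pose u s := p s - d s; pose v s := q s - d s.
have u0 s : 0 <= u s by rewrite subr_ge0 ge_min lexx.
have v0 s : 0 <= v s by rewrite subr_ge0 ge_min lexx orbT.
pose D := \sum_s u s.
have vD : \sum_s v s = D by rewrite /D !sumrB p1 q1.
have D0 : 0 <= D by apply: sumr_ge0.
have scale (w : S -> R) s : (forall s, 0 <= w s) -> \sum_s w s = D ->
    w s * D / D = w s.
  move=> w0 wD; have [DE|DN] := eqVneq D 0; last by rewrite mulfK.
  by rewrite (psumr_eq0P (fun s _ => w0 s) (etrans wD DE)) // !mul0r.
exists [ffun w : S * S => (w.1 == w.2)%:R * d w.1 + u w.1 * v w.2 / D].
  split=> [[s y]|s|y].
  - rewrite ffunE /= addr_ge0 ?mulr_ge0 ?ler0n ?invr_ge0 //.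
    by rewrite le_min p0 q0.
  - under eq_bigr do rewrite ffunE /=.
    rewrite big_split /= (bigD1 s) //= eqxx mul1r big1 ?addr0; last first.
      by move=> y /negPf ys; rewrite eq_sym ys mul0r.
    by rewrite -mulr_suml -mulr_sumr vD scale // /u subrKC.
  - under eq_bigr do rewrite ffunE /=.
    rewrite big_split /= (bigD1 y) //= eqxx mul1r big1 ?addr0; last first.
      by move=> s /negPf ys; rewrite ys mul0r.
    by rewrite -mulr_suml -mulr_suml -/D [D * _]mulrC scale // /v subrKC.
move=> s; rewrite ffunE /= eqxx mul1r /u /v /d.
by case: leP => _; rewrite subrr ?mul0r ?mulr0 ?mul0r addr0.
Qed.

(** The minima bound every coupling entrywise on the diagonal, and maximality is tested against a
    coupling attaining them all. Hence the detection probability does not depend on the choice of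
    maximal coupling. *)
Lemma max_coupling_diag (R : realType) (S : finType) (p q : {ffun S -> R})
    (P : {ffun S * S -> R}) :
  is_dist p -> is_dist q -> is_max_coupling p q P ->
  \sum_s P (s, s) = \sum_s Num.min (p s) (q s).
Proof.
move=> pd qd [Pc Pmax]; apply: le_anti; apply/andP; split.
  by apply: ler_sum => s _; apply: coupling_diag_le.
have [P' /Pmax] := coupling_diag_min pd qd.
rewrite !prob_diag => le P'E; apply: le_trans le.
by under [leRHS]eq_bigr do rewrite P'E.
Qed.

(** Twice the total variation distance of [PY Q b] from the uniform distribution, when [Q] is a
    distribution. *)
Definition discrepancy (R : realType) (S : finType) (m : nat)
    (Q : {ffun 'I_m -> R}) (b : {ffun 'I_m -> S}) : R :=
  \sum_s `|PY Q b s - #|S|%:R^-1|.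

Lemma PSE (R : realType) (S : finType) (s : S) : PS R S s = #|S|%:R^-1.
Proof. by rewrite ffunE in_setT cardsT mul1r. Qed.

Lemma PS_dist (R : realType) (S : finType) : (0 < #|S|)%N -> is_dist (PS R S).
Proof.
move=> S0; split=> [s|]; first by rewrite PSE invr_ge0.
under eq_bigr do rewrite PSE.
by rewrite sumr_const -[LHS]mulr_natr mulVf // pnatr_eq0 -lt0n.
Qed.

Lemma PY_dist (R : realType) (S : finType) (m : nat) (Q : {ffun 'I_m -> R})
    (b : {ffun 'I_m -> S}) : is_dist Q -> is_dist (PY Q b).
Proof.
move=> [Q0 Q1]; split=> [s|]; first by rewrite ffunE sumr_ge0.
by under eq_bigr do rewrite ffunE; rewrite -Q1 (partition_big b xpredT).
Qed.

(** Within a fiber of [b] the coupling mass is split in proportion to [Q]; summing over the fiber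
    recovers it. *)
Lemma Qwm_sum (R : realType) (S : finType) (m : nat)
    (phi : coupling_choice R S m) (Q : {ffun 'I_m -> R})
    (b : {ffun 'I_m -> S}) (s y : S) :
  is_max_choice phi -> is_dist Q ->
  \sum_(x | b x == y) PS R S s * Qwm phi Q b s x = phi Q b (s, y).
Proof.
move=> Hphi Qd; have [[P0 _ Py] _] := Hphi Q b Qd.
have PS0 : PS R S s != 0.
  by rewrite PSE invr_eq0 pnatr_eq0 -lt0n; apply/card_gt0P; exists s.
under eq_bigr => x /eqP bx do
  rewrite /Qwm bx mulrCA divff // mulr1.
rewrite -mulr_suml.
have -> : \sum_(x | b x == y) Q x = PY Q b y by rewrite ffunE.
(* If [PY Q b y] is 0, column [y] of the coupling is nonnegative with sum 0, so its entries
   vanish. *)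
have [PY0|PYN] := eqVneq (PY Q b y) 0; last by rewrite mulrCA divff // mulr1.
rewrite PY0 mul0r; apply/esym.
by apply: (psumr_eq0P (P := xpredT) (F := fun s => phi Q b (s, y))); rewrite ?Py.
Qed.

Lemma prob_joint (R : realType) (S : finType) (m : nat)
    (J : {ffun bool * S * 'I_m -> R}) (E : S -> pred 'I_m) (c : bool) :
  prob J (predI (fun w => E w.1.2 w.2) (fun w => w.1.1 == c))
    = \sum_s \sum_(a | E s a) J (c, s, a).
Proof.
rewrite pair_big_dep /= /prob.
rewrite (reindex_onto (fun p : S * 'I_m => (c, p.1, p.2))
                      (fun w => (w.1.2, w.2))) /=.
  by apply: eq_bigl => -[s a] /=; rewrite !eqxx !andbT.
by move=> [[c' s] a] /= /andP[_ /eqP ->].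
Qed.

(** Write [D] for the discrepancy and [k] for [#|S|]. For [C = 1] the match probability is the
    diagonal mass [1 - D/2]; for [C = 0], [A] is independent of the uniform [S] and the mismatch
    probability is [1 - 1/k]. *)
Lemma Rd_discrepancy (R : realType) (S : finType) (m : nat)
    (phi : coupling_choice R S m) (Q : {ffun 'I_m -> R})
    (b : {ffun 'I_m -> S}) :
  (0 < #|S|)%N -> is_max_choice phi -> is_dist Q ->
  Rd phi Q b = 1 - (2 * #|S|%:R)^-1 - 4^-1 * discrepancy Q b.
Proof.
move=> S0 Hphi Qd; have [PS0 PS1] := PS_dist R S0.
have [PY0 PY1] := PY_dist b Qd; have [[_ Ps _] _] := Hphi Q b Qd.
have k0 : #|S|%:R != 0 :> R by rewrite pnatr_eq0 -lt0n.
rewrite /Rd /cprob; set J := joint _ _ _.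
have Jc c : prob J (fun w => w.1.1 == c) = \sum_s \sum_a J (c, s, a).
  by rewrite -(prob_joint J (fun=> xpredT)); apply: eq_bigl => w /=.
have J1 s y : \sum_(a | b a == y) J (true, s, a) = 2^-1 * phi Q b (s, y).
  rewrite -(Qwm_sum b s y Hphi Qd) mulr_sumr.
  by apply: eq_bigr => a _; rewrite [LHS]ffunE /= -mulrA.
rewrite (prob_joint J (fun s a => b a == s)) (prob_joint J (fun s a => b a != s)).
rewrite !Jc.
have -> : \sum_s \sum_a J (true, s, a) = 2^-1.
  under eq_bigr => s _.
    rewrite (partition_big b xpredT) //=.
    under eq_bigr do rewrite J1.
    rewrite -mulr_sumr Ps.
  over.
  by rewrite -mulr_sumr PS1 mulr1.
under eq_bigr do rewrite J1.
rewrite -mulr_sumr.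
rewrite (max_coupling_diag (PS_dist R S0) (PY_dist b Qd) (Hphi Q b Qd)).
have -> : \sum_s \sum_a J (false, s, a) = 2^-1.
  under eq_bigr => s _ do under eq_bigr => a _ do rewrite ffunE.
  under eq_bigr => s _ do rewrite -mulr_sumr Qd.2 mulr1.
  by rewrite -mulr_sumr PS1 mulr1.
have -> : \sum_s \sum_(a | b a != s) J (false, s, a) = 2^-1 * (1 - #|S|%:R^-1).
  have E s : \sum_(a | b a != s) J (false, s, a)
      = 2^-1 * #|S|%:R^-1 * (1 - PY Q b s).
    under eq_bigr => a _ do rewrite ffunE PSE.
    rewrite -mulr_sumr; congr (_ * _); apply/eqP; rewrite eq_sym subr_eq ffunE.
    by rewrite -Qd.2 (bigID (fun a => b a == s)) addrC.
  under eq_bigr => s _ do rewrite E.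
  rewrite -mulr_sumr sumrB PY1 sumr_const -mulrA; congr (_ * _).
  by rewrite mulrBr mulr1 mulVf.
have -> : \sum_s Num.min (PS R S s) (PY Q b s) = 1 - 2^-1 * discrepancy Q b.
  have E s : Num.min (PS R S s) (PY Q b s)
      = 2^-1 * (PS R S s + PY Q b s - `|PY Q b s - #|S|%:R^-1|).
    by rewrite PSE; case: leP; case: ger0P; lra.
  under eq_bigr => s _ do rewrite E.
  by rewrite -mulr_sumr sumrB big_split /= PS1 PY1 -/(discrepancy Q b); lra.
by field.
Qed.

(** * Balanced maps and the max-min value *)

(** The alphabet is arbitrary so that ['I_k] and [bool] are covered by one argument. *)
Definition balanced_maps (S : finType) (m N : nat) : {set {ffun 'I_m -> S}} :=
  [set b : {ffun 'I_m -> S} | [forall s, #|[set i | b i == s]| == N]].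

Lemma balanced_maps_neq0 (S : finType) (m N : nat) :
  m = (#|S| * N)%N -> balanced_maps S m N != set0.
Proof.
move=> mE; have cE : #|{: S * 'I_N}| = m by rewrite card_prod card_ord.
(* Tokens are numbered by the pairs in [S * 'I_N] and mapped to the first component. *)
apply/set0Pn; exists [ffun i => (enum_val (cast_ord (esym cE) i)).1].
rewrite inE; apply/forallP => s; apply/eqP.
rewrite -[RHS]card_ord -[RHS]cardsT.
pose h (j : 'I_N) := cast_ord cE (enum_rank (s, j)).
have hi : injective h by move=> i j /cast_ord_inj/enum_rank_inj[].
rewrite -[RHS](card_imset _ hi); apply: eq_card => i.
rewrite inE ffunE; apply/eqP/imsetP => [sE|[j _ ->]].
  exists (enum_val (cast_ord (esym cE) i)).2; first by rewrite inE.
  by rewrite /h -sE -surjective_pairing enum_valK cast_ordKV.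
by rewrite /h cast_ordK enum_rankK.
Qed.

Lemma expect_unif (R : realType) (T : finType) (A : {set T}) (f : T -> R) :
  expect (unif R A) f = (\sum_(x in A) f x) / #|A|%:R.
Proof.
rewrite /expect mulr_suml [RHS]big_mkcond; apply: eq_bigr => x _.
by rewrite ffunE; case: ifP => _; rewrite ?mul0r // mul1r mulrC.
Qed.

Lemma unif_dist (R : realType) (T : finType) (A : {set T}) :
  A != set0 -> is_dist (unif R A).
Proof.
move=> A0; have A1 : #|A|%:R != 0 :> R by rewrite pnatr_eq0 cards_eq0.
split=> [x|]; first by rewrite ffunE divr_ge0.
have := expect_unif A (fun=> 1 : R); rewrite sumr_const divff // => <-.
by apply: eq_bigr => x _; rewrite mulr1.
Qed.

Lemma sum_discrepancy_vertices (R : realType) (S : finType) (m : nat)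
    (lambda : R) (t : nat) (b : {ffun 'I_m -> S}) :
  \sum_(w in vertices m t) discrepancy (vertex lambda t w) b
    = \sum_s deviation lambda t #|S|%:R^-1 [set x | b x == s].
Proof.
rewrite exchange_big; apply: eq_bigr => s _; apply: eq_bigr => w _.
by congr `|_ - _|; rewrite ffunE; apply: eq_bigl => x; rewrite inE.
Qed.

Lemma sum_card_fibers (S : finType) (m : nat) (b : {ffun 'I_m -> S}) :
  (\sum_s #|[set x | b x == s]| = m)%N.
Proof.
rewrite -[RHS]card_ord -sum1_card (partition_big b xpredT) //=.
by apply: eq_bigr => s _; rewrite -sum1_card; apply: eq_bigl => x; rewrite inE.
Qed.

Lemma card_initial_segment (m n : nat) :
  (n <= m)%N -> #|[set x : 'I_m | (x < n)%N]| = n.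
Proof.
move=> nm; rewrite -[RHS](card_ord n) -[RHS]cardsT.
have wi : injective (widen_ord nm) by move=> i j /(congr1 val) ij; apply: val_inj.
rewrite -[RHS](card_imset _ wi); apply: eq_card => x; rewrite inE.
apply/idP/imsetP => [xn|[j _ ->] /=]; last exact: ltn_ord.
by exists (Ordinal xn); [rewrite inE|apply: val_inj].
Qed.

(** The deviation of a fiber is a convex function of its size, and the fiber sizes have mean [N], so
    [convex_seq_sum] applies. *)
Lemma sum_discrepancy_ge (R : realType) (S : finType) (m N : nat) (lambda : R)
    (t : nat) (b : {ffun 'I_m -> S}) (A : {set 'I_m}) :
  0 <= lambda -> t%:R * lambda <= 1 ->
  m = (#|S| * N)%N -> (0 < m)%N -> #|A| = N ->
  #|S|%:R * deviation lambda t #|S|%:R^-1 A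
    <= \sum_(w in vertices m t) discrepancy (vertex lambda t w) b.
Proof.
move=> lam0 lam1 mE m0 AN; rewrite sum_discrepancy_vertices.
pose f n := deviation lambda t #|S|%:R^-1 [set x : 'I_m | (x < n)%N].
have fE (B : {set 'I_m}) : deviation lambda t #|S|%:R^-1 B = f #|B|.
  apply: deviation_card; rewrite card_initial_segment //.
  by rewrite -[leqRHS](card_ord m) max_card.
under [leRHS]eq_bigr do rewrite fE.
rewrite fE AN; apply: (convex_seq_sum (m := m)).
- by move=> i im; apply: deviation_convex.
- have S0 : (0 < #|S|)%N by case: #|S| mE m0 => // ->.
  have N0 : (0 < N)%N by case: N mE {AN} m0 => //; rewrite muln0 => ->.
  by rewrite N0 mE leq_pmull.
- by move=> s; rewrite -[leqRHS](card_ord m) max_card.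
by rewrite sum_card_fibers.
Qed.

Lemma sum_discrepancy_balanced (R : realType) (S : finType) (m N : nat)
    (lambda : R) (t : nat) (b : {ffun 'I_m -> S}) (A : {set 'I_m}) :
  b \in balanced_maps S m N -> #|A| = N ->
  \sum_(w in vertices m t) discrepancy (vertex lambda t w) b
    = #|S|%:R * deviation lambda t #|S|%:R^-1 A.
Proof.
rewrite inE => /forallP bN AN; rewrite sum_discrepancy_vertices.
rewrite (eq_bigr (fun=> deviation lambda t #|S|%:R^-1 A)).
  by rewrite sumr_const mulr_natl.
by move=> s _; apply: deviation_card; rewrite AN; apply/eqP/bN.
Qed.

(** A permutation matching the two sets is followed by a transposition matching the extra points. *)
Lemma vertices_transitive (m t : nat) (w w' : {set 'I_m} * 'I_m) :
  w \in vertices m t -> w' \in vertices m t ->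
  exists s : {perm 'I_m}, permute_vertex s w = w'.
Proof.
rewrite !inE => /andP[/eqP Tt wy] /andP[/eqP Tt' wy'].
have [|s Hs] := @perm_of_card _ w.1 w'.1; first by rewrite Tt Tt'.
pose p := tperm (s w.2) w'.2.
(* Both points lie in [w'.1] if it is everything and outside it otherwise, so the transposition
   preserves [w'.1]. *)
have same : (s w.2 \in w'.1) = (w'.2 \in w'.1).
  rewrite Hs; have TT : (w.1 == setT) = (w'.1 == setT).
    by rewrite !eqEcard !subsetT Tt Tt'.
  move: wy wy'; rewrite TT.
  have [T'|_] := eqVneq w'.1 setT; last by rewrite !orbF => /negPf-> /negPf->.
  by move/eqP: TT; rewrite T' eqxx => /eqP/eqP ->; rewrite !inE.
have Hp x : (p x \in w'.1) = (x \in w'.1).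
  by rewrite /p; case: tpermP => [->|->|].
exists (s * p)%g; rewrite [RHS]surjective_pairing; congr (_, _).
  apply/eqP; rewrite eqEcard card_imset ?Tt ?Tt' ?leqnn ?andbT; last exact: perm_inj.
  by apply/subsetP => _ /imsetP[x xw ->]; rewrite permM Hp Hs.
by rewrite permM /p tpermL.
Qed.

(** Precomposing [b] with [s] permutes the balanced maps and moves [s] from the extreme point to the
    map. *)
Lemma balanced_discrepancy_permute (R : realType) (S : finType) (m N : nat)
    (lambda : R) (t : nat) (s : {perm 'I_m}) (w : {set 'I_m} * 'I_m) :
  \sum_(b in balanced_maps S m N)
     discrepancy (vertex lambda t (permute_vertex s w)) b
  = \sum_(b in balanced_maps S m N) discrepancy (vertex lambda t w) b.
Proof.
pose h (b : {ffun 'I_m -> S}) := [ffun x => b (s x)].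
have hi : injective h.
  move=> b c /ffunP bc; apply/ffunP => x.
  by have := bc (s^-1 x)%g; rewrite !ffunE permKV.
rewrite [RHS](reindex_inj hi); apply: eq_big => [b|b _].
  rewrite !inE; apply: eq_forallb => y; congr (_ == _).
  rewrite -[RHS](card_imset _ (@perm_inj _ s)); apply: eq_card => x.
  rewrite inE; apply/idP/imsetP => [bx|[z + ->]]; last by rewrite inE ffunE.
  by exists (s^-1 x)%g; rewrite ?inE ?ffunE permKV.
apply: eq_bigr => y _; congr `|_ - _|; rewrite !ffunE.
rewrite (reindex_inj (@perm_inj _ s)); apply: eq_big => x; first by rewrite ffunE.
by rewrite vertex_permute.
Qed.

Lemma card_vertices_gt0 (m t : nat) :
  (0 < m)%N -> (t <= m)%N -> (0 < #|vertices m t|)%N.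
Proof.
move=> m0 tm; rewrite card_vertices // muln_gt0 bin_gt0 tm /=.
by case: eqVneq => // tm'; rewrite subn_gt0 ltn_neqAle tm'.
Qed.

(** The double sum over extreme points and balanced maps is evaluated in both orders: by
    transitivity one inner sum is constant, by balance the other. *)
Lemma expect_balanced_vertex (R : realType) (S : finType) (m N : nat)
    (lambda : R) (t : nat) (w : {set 'I_m} * 'I_m) (A : {set 'I_m}) :
  m = (#|S| * N)%N -> #|A| = N -> w \in vertices m t ->
  expect (unif R (balanced_maps S m N)) (discrepancy (vertex lambda t w))
    = #|S|%:R * deviation lambda t #|S|%:R^-1 A / #|vertices m t|%:R.
Proof.
move=> mE AN wV; rewrite expect_unif.
set B := balanced_maps S m N.
have B0 : #|B|%:R != 0 :> R by rewrite pnatr_eq0 cards_eq0 balanced_maps_neq0.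
have V0 : #|vertices m t|%:R != 0 :> R.
  by rewrite pnatr_eq0 -lt0n; apply/card_gt0P; exists w.
apply/eqP; rewrite eqr_div //; apply/eqP.
transitivity (\sum_(v in vertices m t) \sum_(b in B) discrepancy (vertex lambda t v) b).
  rewrite [RHS](eq_bigr (fun=> \sum_(b in B) discrepancy (vertex lambda t w) b)).
    by rewrite sumr_const mulr_natr.
  move=> v vV; have [s <-] := vertices_transitive wV vV.
  exact: balanced_discrepancy_permute.
rewrite exchange_big /=.
rewrite (eq_bigr (fun=> #|S|%:R * deviation lambda t #|S|%:R^-1 A)).
  by rewrite sumr_const mulr_natr.
by move=> b bB; apply: sum_discrepancy_balanced bB AN.
Qed.

(** The number of choices of [y] cancels; ['C(m, t)] remains and normalizes the hypergeometric
    weights. *)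
Lemma deviation_Gterm (R : realType) (m k t : nat) (lambda : R)
    (A : {set 'I_m}) :
  (0 < m)%N -> (t <= m)%N -> #|A| = (m %/ k)%N ->
  k%:R * deviation lambda t k%:R^-1 A / #|vertices m t|%:R
    = Gterm m k t lambda.
Proof.
move=> m0 tm AN; have := card_vertices_gt0 m0 tm.
rewrite deviation_closed_form // card_vertices // AN /Gterm.
set D := (if t == m then m else _)%N => CD0.
have D0 : D%:R != 0 :> R by rewrite pnatr_eq0; move: CD0; case: D; rewrite ?muln0.
have C0 : 'C(m, t)%:R != 0 :> R by rewrite pnatr_eq0 -lt0n bin_gt0.
rewrite natrM -mulrA; congr (_ * _).
rewrite mulrC mulrA invfM mulfVK // mulr_sumr; apply: eq_bigr => c _.
by rewrite natrM /fill_ratio /=; ring.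
Qed.

Lemma truncn_inv_bounds (R : realType) (m : nat) (lambda : R) :
  (0 < m)%N -> m%:R^-1 <= lambda -> let t := Num.truncn lambda^-1 in
  [/\ t%:R * lambda <= 1 < t.+1%:R * lambda, (t <= m)%N
    & t = m -> t%:R * lambda = 1].
Proof.
move=> m0 ml t; have m0R : 0 < m%:R :> R by rewrite ltr0n.
have lam0 : 0 < lambda by apply: lt_le_trans ml; rewrite invr_gt0.
have mlam : 1 <= m%:R * lambda by rewrite mulrC -ler_pdivrMr // mul1r.
have /andP[t1 t2] : t%:R <= lambda^-1 < t.+1%:R.
  by apply: truncn_itv; rewrite invr_ge0 ltW.
have tl : t%:R * lambda <= 1 by rewrite -ler_pdivlMr // div1r.
split=> [||tm]; last by apply: le_anti; rewrite tl tm mlam.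
  by rewrite tl -ltr_pdivrMr // div1r.
rewrite -(ler_nat R) -(ler_pM2r lam0); exact: le_trans mlam.
Qed.

(** The remaining mass lies in [[0, lambda)]. If [t = m], it has no place outside [T], and the total
    is 1 because it is 0. *)
Lemma vertex_feasible (R : realType) (m t : nat) (lambda : R)
    (w : {set 'I_m} * 'I_m) :
  t%:R * lambda <= 1 < t.+1%:R * lambda -> (t = m -> t%:R * lambda = 1) ->
  w \in vertices m t -> feasible lambda (vertex lambda t w).
Proof.
move=> ht tm; rewrite inE => /andP[/eqP Tt wy].
have /andP[t1 t2] := ht; rewrite -natr1 in t2.
have lam0 : 0 <= lambda by lra.
apply/feasibleP => //; split; last first.
  by move=> x; rewrite ffunE; case: ifP => // _; case: ifP => // _; lra.
split=> [x|].
  by rewrite ffunE; case: ifP => // _; case: ifP => // _; lra.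
rewrite -(eq_bigl _ _ (in_setT (T := 'I_m))) sum_vertex setIT Tt in_setT /=.
case: (boolP (w.2 \in w.1)) wy => [_ /= /eqP TT|_ _]; last by rewrite mul1r; ring.
by rewrite mul0r addr0 tm // -Tt TT cardsT card_ord.
Qed.

Lemma expect_discrepancy_convex (R : realType) (S : finType) (m : nat)
    (PB : {ffun {ffun 'I_m -> S} -> R}) :
  is_dist PB -> convex_fun (fun Q => expect PB (discrepancy Q)).
Proof.
move=> [PB0 _] a Q Q1 Q2 /andP[a0 a1] QE; rewrite /expect !mulr_sumr -big_split.
apply: ler_sum => b _ /=; rewrite !(mulrCA _ (PB b)) -mulrDr.
apply: ler_wpM2l => //; rewrite /discrepancy !mulr_sumr -big_split.
apply: ler_sum => s _ /=; have a1' : 0 <= 1 - a by rewrite subr_ge0.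
have -> : PY Q b s - #|S|%:R^-1 = a * (PY Q1 b s - #|S|%:R^-1)
    + (1 - a) * (PY Q2 b s - #|S|%:R^-1).
  have -> : PY Q b s = a * PY Q1 b s + (1 - a) * PY Q2 b s.
    by rewrite !ffunE !mulr_sumr -big_split; apply: eq_bigr => x _; apply: QE.
  by ring.
by apply: le_trans (ler_normD _ _) _; rewrite !normrM (ger0_norm a0) (ger0_norm a1').
Qed.

Lemma expect_Rd (R : realType) (S : finType) (m : nat)
    (phi : coupling_choice R S m) (PB : {ffun {ffun 'I_m -> S} -> R})
    (Q : {ffun 'I_m -> R}) :
  (0 < #|S|)%N -> is_max_choice phi -> is_dist PB -> is_dist Q ->
  expect PB (Rd phi Q)
    = 1 - (2 * #|S|%:R)^-1 - 4^-1 * expect PB (discrepancy Q).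
Proof.
move=> S0 Hphi [_ PB1] Qd; rewrite /expect mulr_sumr -[X in X - _]mulr1 -PB1.
rewrite mulr_sumr -sumrB; apply: eq_bigr => b _.
by rewrite Rd_discrepancy // PB1; ring.
Qed.

Lemma worst_case_values (R : realType) (S : finType) (k m : nat) (lambda : R)
    (phi : coupling_choice R S m) :
  #|S| = k -> (0 < k)%N -> (0 < m)%N -> (k %| m)%N -> m%:R^-1 <= lambda ->
  is_max_choice phi ->
  let v := 1 - (2 * k%:R)^-1
           - 4^-1 * Gterm m k (Num.truncn lambda^-1) lambda in
  exists W : {ffun {ffun 'I_m -> S} -> R} -> R,
  [/\ forall PB, is_dist PB -> is_worst_case phi lambda PB (W PB),
      forall PB, is_dist PB -> W PB <= v
    & W (unif R (balanced_maps S m (m %/ k))) = v].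
Proof.
move=> Sk k0 m0 km ml Hphi v; have [] := truncn_inv_bounds m0 ml.
set t := Num.truncn _ in v * => ht tm tmE; have /andP[t1 t2] := ht.
have lam0 : 0 <= lambda by rewrite -natr1 in t2; lra.
have S0 : (0 < #|S|)%N by rewrite Sk.
have mE : m = (#|S| * (m %/ k))%N by rewrite Sk mulnC divnK.
pose A := [set x : 'I_m | (x < m %/ k)%N].
have AN : #|A| = (m %/ k)%N by rewrite card_initial_segment // leq_div.
have VE := deviation_Gterm lambda m0 tm AN.
have V0 := card_vertices_gt0 m0 tm.
have [w0 w0V] : exists w0, w0 \in vertices m t by apply/card_gt0P.
pose F (PB : {ffun {ffun 'I_m -> S} -> R}) w :=
  expect PB (discrepancy (S := S) (vertex lambda t w)).
(* A worst [Q] can be sought among the finitely many extreme points, so the minimum is attained. *)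
pose wmax PB := [arg max_(w > w0 in vertices m t) F PB w]%O.
have wmaxP PB : wmax PB \in vertices m t
    /\ forall w, w \in vertices m t -> F PB w <= F PB (wmax PB).
  by rewrite /wmax; case: arg_maxP.
exists (fun PB => 1 - (2 * k%:R)^-1 - 4^-1 * F PB (wmax PB)); split.
- move=> PB PBd; have [wV wm] := wmaxP PB; split.
    have Qf := vertex_feasible ht tmE wV; exists (vertex lambda t (wmax PB)) => //.
    by rewrite expect_Rd ?Sk //; case/(feasibleP _ lam0): Qf.
  move=> Q Qf; rewrite expect_Rd ?Sk //; last by case/(feasibleP _ lam0): Qf.
  have [w wV' le] := convex_fun_le_vertex m0 ht (expect_discrepancy_convex PBd) Qf.
  rewrite lerB // ler_pM2l ?invr_gt0 ?ltr0n //; exact: le_trans le (wm _ wV').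
- move=> PB [PB0 PB1]; have [wV wm] := wmaxP PB.
  rewrite /v lerB // ler_pM2l ?invr_gt0 ?ltr0n // -VE.
  rewrite ler_pdivrMr ?ltr0n // -Sk.
  (* The maximum is at least the average over extreme points; after exchanging the sums, the lower
     bound is applied for each fixed [b]. *)
  have le1 : \sum_(w in vertices m t) F PB w <= F PB (wmax PB) * #|vertices m t|%:R.
    by rewrite mulr_natr -sumr_const; apply: ler_sum.
  apply: le_trans le1; rewrite exchange_big /=.
  set L := (X in X <= _); rewrite -[L]mul1r -PB1 mulr_suml; apply: ler_sum => b _.
  rewrite -mulr_sumr; apply: ler_wpM2l => //.
  exact: (sum_discrepancy_ge b lam0 t1 mE m0 AN).
(* For the balanced law [F] is constant on the extreme points, so any choice of [wmax] gives the
   value. *)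
rewrite /v /F (expect_balanced_vertex _ mE AN) ?Sk ?VE //.
by have [] := wmaxP (unif R (balanced_maps S m (m %/ k))).
Qed.

Lemma Rdstar_maximizer (R : realType) (S : finType) (k m : nat) (lambda : R)
    (phi : coupling_choice R S m) :
  #|S| = k -> (0 < k)%N -> (0 < m)%N -> (k %| m)%N -> m%:R^-1 <= lambda ->
  is_max_choice phi ->
  is_Rdstar phi lambda (1 - (2 * k%:R)^-1
    - 4^-1 * Gterm m k (Num.truncn lambda^-1) lambda)
  /\ is_maximizer phi lambda (unif R (balanced_maps S m (m %/ k))).
Proof.
move=> Sk k0 m0 km ml Hphi.
have [W [WP Wle Wbal]] := worst_case_values Sk k0 m0 km ml Hphi.
have Bd : is_dist (unif R (balanced_maps S m (m %/ k))).
  by apply/unif_dist/balanced_maps_neq0; rewrite Sk mulnC divnK.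
have star : is_Rdstar phi lambda (1 - (2 * k%:R)^-1
    - 4^-1 * Gterm m k (Num.truncn lambda^-1) lambda).
  exists W; split=> //; split=> //.
  by exists (unif R (balanced_maps S m (m %/ k))).
split=> //; split=> //.
by eexists; [exact: star|rewrite -Wbal; exact: WP].
Qed.

(** The two counts add up to [m], so if equal they are both [m %/ 2]; for odd [m] both sets are
    empty. *)
Lemma balanced_bitsE (m : nat) :
  balanced_bits m = balanced_maps bool m (m %/ 2).
Proof.
apply/setP => b; rewrite !inE.
have bm : (#|[set i | b i == true]| + #|[set i | b i == false]| = m)%N.
  by have := sum_card_fibers b; rewrite big_bool.
apply/eqP/forallP => [E|E]; last by rewrite (eqP (E false)) (eqP (E true)).
have half := congr1 (divn^~ 2) bm; rewrite /= E addnn -muln2 mulnK // in half.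
by case; rewrite -half ?E.
Qed.

Theorem theorem3 (R : realType) (k m : nat) (lambda : R)
  (phi : coupling_choice R 'I_k m) :
  (0 < k)%N -> (0 < m)%N -> (k %| m)%N ->
  m%:R^-1 <= lambda <= 1 ->
  is_max_choice phi ->
  let t := Num.truncn (lambda^-1) in
  [/\ is_Rdstar phi lambda
        (1 - (2 * k%:R)^-1 - 4^-1 * Gterm m k t lambda),
      is_maximizer phi lambda (unif R (balanced m k))
    & k = 2%N ->
      forall psi : coupling_choice R bool m, is_max_choice psi ->
      is_maximizer psi lambda (unif R (balanced_bits m))].
Proof.
move=> k0 m0 km /andP[ml _] Hphi t.
have [star bal] := Rdstar_maximizer (card_ord k) k0 m0 km ml Hphi.
(* [balanced m k] agrees with [balanced_maps] over ['I_k] by conversion; the bit version needs a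
   rewrite. *)
split=> // k2 psi Hpsi; rewrite k2 in km; rewrite balanced_bitsE.
by have [] := Rdstar_maximizer card_bool isT m0 km ml Hpsi.
Qed.
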